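(* Let $n\ge1$, $\nu\ge1$ be integers and $\delta\in\{0,1,2\}$, and suppose it is not the case that $\delta=0$ and $\nu$ is odd. Then the chromatic number of $\mathcal{O}^{(2\nu+\delta)}_{2^n}$ is $2^{\nu+\delta-1}+1$.
   Context: Let $V^{2\nu+\delta}$ be the set of tuples $\vec a=(a_1,\ldots,a_{2\nu+\delta})\in(\mathbb{Z}_{2^n})^{2\nu+\delta}$ such that some $a_i$ is a unit of $\mathbb{Z}_{2^n}$. Write $\vec a\sim\vec b$ if $\vec a=\lambda\vec b$ for some $\lambda\in\mathbb{Z}_{2^n}^\times$, let $[\vec a]$ denote the equivalence class and $V^{2\nu+\delta}_\sim$ the set of classes. Let $G_{2\nu+\delta,\Delta}=\begin{pmatrix}0&I_\nu&\\ &0&\\ &&\Delta\end{pmatrix}$ over $\mathbb{Z}_{2^n}$ (first two block sizes $\nu$, unspecified blocks zero), where $\Delta$ is empty if $\delta=0$, $\Delta=(1)$ if $\delta=1$, and $\Delta=\begin{pmatrix}z&1\\0&z\end{pmatrix}$ if $\delta=2$, with $z$ a fixed unit of $\mathbb{Z}_{2^n}$. The orthogonal graph $\mathcal{O}^{(2\nu+\delta)}_{2^n}$ has vertex set $\{[\vec a]\in V^{2\nu+\delta}_\sim:\vec a\,G_{2\nu+\delta,\Delta}\,\vec a^t=0\}$, with $[\vec a]$ adjacent to $[\vec b]$ iff $\vec a(G_{2\nu+\delta,\Delta}+G_{2\nu+\delta,\Delta}^t)\vec b^t\in\mathbb{Z}_{2^n}^\times$. *)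

(* Defs.v *)
From HB Require Import structures.
From mathcomp Require Import all_boot all_order all_algebra.
Set Implicit Arguments. Unset Strict Implicit. Unset Printing Implicit Defensive.
Import GRing.Theory.
Local Open Scope ring_scope.

(* The ring Z_{2^n} is 'Z_(2^n) (valid for n >= 1, since 2^n >= 2). *)

(* The Gram matrix G_{2nu+delta,Delta}: I_nu in the upper-right of the 2nu x 2nu
   block, and Delta (empty / (1) / [[z,1],[0,z]]) in the last delta x delta block. *)
Definition Gmat (n nu delta : nat) (z : 'Z_(2 ^ n)) : 'M['Z_(2 ^ n)]_(2 * nu + delta) :=
  \matrix_(i, j)
    (if ((i < nu) && (j == i + nu :> nat))%N then 1
     else if ((2 * nu <= i) && (i == j :> nat))%N then (if delta == 1%N then 1 else z)
     else if [&& delta == 2%N, (i == 2 * nu :> nat) & (j == (2 * nu).+1 :> nat)]%N then 1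
     else 0).

Definition unimodular (n m : nat) (a : 'rV['Z_(2 ^ n)]_m) : bool :=
  [exists i, a 0 i \is a GRing.unit].

Definition vclass (n m : nat) (a : 'rV['Z_(2 ^ n)]_m) : {set 'rV['Z_(2 ^ n)]_m} :=
  [set b | [exists l : 'Z_(2 ^ n), (l \is a GRing.unit) && (b == l *: a)]].

Definition orth_vertices (n nu delta : nat) (z : 'Z_(2 ^ n))
  : {set {set 'rV['Z_(2 ^ n)]_(2 * nu + delta)}} :=
  [set vclass a | a in [pred a : 'rV['Z_(2 ^ n)]_(2 * nu + delta) |
      unimodular a && ((a *m Gmat nu delta z *m a^T) 0 0 == 0)]].

Definition orth_adj (n nu delta : nat) (z : 'Z_(2 ^ n))
  (A B : {set 'rV['Z_(2 ^ n)]_(2 * nu + delta)}) : bool :=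
  [exists a in A, exists b in B,
    (a *m (Gmat nu delta z + (Gmat nu delta z)^T) *m b^T) 0 0 \is a GRing.unit].

Definition orth_colorable (n nu delta : nat) (z : 'Z_(2 ^ n)) (k : nat) : Prop :=
  exists f : {set 'rV['Z_(2 ^ n)]_(2 * nu + delta)} -> nat,
    (forall A, A \in orth_vertices nu delta z -> (f A < k)%N) /\
    (forall A B, A \in orth_vertices nu delta z -> B \in orth_vertices nu delta z ->
       orth_adj z A B -> f A <> f B).

Definition orth_chromatic_number (n nu delta : nat) (z : 'Z_(2 ^ n)) (k : nat) : Prop :=
  orth_colorable nu delta z k /\ (forall j, orth_colorable nu delta z j -> (k <= j)%N).

(* Main.v *)
(** Everything takes place modulo 2: adjacency only depends on residues, and every
   nonzero singular vector over F_2 lifts to a singular unimodular vector over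
   Z/2^n, by adjusting one coordinate paired with a unit. A color class then
   reduces to a set of nonzero pairwise orthogonal singular vectors, which spans a
   totally singular subspace of dimension at most nu and so has at most 2^nu - 1
   elements; since there are (2^nu - 1)(2^(nu+delta-1) + 1) nonzero singular
   vectors, at least 2^(nu+delta-1) + 1 colors are needed. Conversely, spreads
   provide colorings. For delta = 1, 2 the polar form modulo 2 is, up to its
   radical, the symplectic form tr(x y' + x' y) on F x F with F = GF(2^(nu+delta-1)),
   and the lines through the origin of F x F are totally isotropic. For delta = 0
   and nu even one uses Kantor's orthogonal spread, built from GF(2^(nu-1)), where
   tr 1 = 1 because nu - 1 is odd. *)
Require Import Defs.
From HB Require Import structures.
From mathcomp Require Import all_boot all_order all_algebra.
From mathcomp Require Import all_field.
From mathcomp Require Import ring zify.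

Set Implicit Arguments. Unset Strict Implicit. Unset Printing Implicit Defensive.
Import GRing.Theory.
Local Open Scope ring_scope.

(** * The absolute trace of a finite field of characteristic 2 *)

(** The trace from GF(2^m) to F_2 with its values kept in [F]; lying in F_2 is expressed below by
    c^2 = c. *)
Definition abs_trace (F : finFieldType) (m : nat) (x : F) : F :=
  \sum_(i < m) x ^+ (2 ^ i).

Lemma sqrrD_pchar2 (R : comNzRingType) (x y : R) :
  2%N \in [pchar R] -> (x + y) ^+ 2 = x ^+ 2 + y ^+ 2.
Proof. by move=> charR; rewrite sqrrD -mulr_natr pcharf0 // mulr0 addr0. Qed.

Lemma exprD_pchar2 (R : comNzRingType) (i : nat) (x y : R) :
  2%N \in [pchar R] -> (x + y) ^+ (2 ^ i) = x ^+ (2 ^ i) + y ^+ (2 ^ i).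
Proof.
by move=> charR; elim: i => [//|i IHi]; rewrite expnSr !exprM IHi sqrrD_pchar2.
Qed.

Lemma idem01 (R : idomainType) (c : R) : c ^+ 2 = c -> c = 0 \/ c = 1.
Proof.
move/eqP; rewrite -subr_eq0 expr2 -[X in _ - X]mulr1 -mulrBr.
by rewrite mulf_eq0 subr_eq0 => /orP[] /eqP; [left | right].
Qed.

Section AbsoluteTrace.

Variables (F : finFieldType) (m : nat).
Hypotheses (charF : 2%N \in [pchar F]) (cardF : #|F| = (2 ^ m)%N).

Local Notation tr := (@abs_trace F m).

Lemma degree_gt0 : (0 < m)%N.
Proof.
by rewrite lt0n; apply/eqP => m0; have := finNzRing_gt1 F; rewrite cardF m0.
Qed.

Lemma abs_trace0 : tr 0 = 0.
Proof. by rewrite /abs_trace big1 // => i _; rewrite expr0n expn_eq0. Qed.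

Lemma abs_traceD x y : tr (x + y) = tr x + tr y.
Proof.
by rewrite /abs_trace -big_split; apply: eq_bigr => i _; rewrite exprD_pchar2.
Qed.

Lemma abs_trace_sum (I : Type) (r : seq I) (P : pred I) (f : I -> F) :
  tr (\sum_(i <- r | P i) f i) = \sum_(i <- r | P i) tr (f i).
Proof. exact: (big_morph tr abs_traceD abs_trace0). Qed.

Lemma abs_traceMn x k : tr (k%:R * x) = k%:R * tr x.
Proof.
elim: k => [|k IHk]; first by rewrite !mul0r abs_trace0.
by rewrite -natr1 !mulrDl !mul1r abs_traceD IHk.
Qed.

(** Squaring permutes the terms x^(2^i) cyclically, because x^(2^m) = x. *)
Lemma abs_trace_sqr x : tr (x ^+ 2) = tr x.
Proof.
rewrite /abs_trace; move: degree_gt0 cardF; case: m => // k _ cardFk.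
rewrite big_ord_recr big_ord_recl /= -exprM -expnS -cardFk expf_card addrC.
by congr (_ + _); apply: eq_bigr => i _; rewrite -exprM -expnS.
Qed.

Lemma sqr_abs_trace x : tr x ^+ 2 = tr x.
Proof.
rewrite -[RHS]abs_trace_sqr /abs_trace.
rewrite (big_morph (fun x => x ^+ 2) (fun a b => sqrrD_pchar2 a b charF)
  (expr0n F 2)).
by apply: eq_bigr => i _; rewrite -!exprM mulnC.
Qed.

Lemma abs_trace01 x : tr x = 0 \/ tr x = 1.
Proof. exact: idem01 (sqr_abs_trace x). Qed.

Lemma abs_trace1 : tr 1 = m%:R.
Proof.
by rewrite /abs_trace (eq_bigr (fun=> 1)) ?sumr_const ?card_ord // => i _;
  rewrite expr1n.
Qed.

(** The trace is given by a polynomial of degree at most 2^(m-1), nonzero because its coefficient at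
    X is 1; it has too few roots to vanish on all 2^m elements. *)
Lemma abs_trace_neq0 : exists x, tr x != 0.
Proof.
apply/existsP; rewrite -negb_forall; apply/negP => /forallP tr0.
have m_gt0 := degree_gt0.
pose p : {poly F} := \sum_(i < m) 'X^(2 ^ i).
have p1 : p`_1 = 1.
  rewrite /p coef_sum; case: m m_gt0 => // k _.
  rewrite big_ord_recl coefXn /= big1 ?addr0 // => i _.
  by rewrite coefXn -[X in X == _](expn0 2) eqn_exp2l.
have p_neq0 : p != 0 by apply: contra_eq_neq p1 => ->; rewrite coef0 eq_sym oner_eq0.
have : (size (enum F) < size p)%N.
  apply: max_poly_roots; rewrite ?enum_uniq //.
  apply/allP => x _; rewrite rootE horner_sum; apply/eqP.
  by apply: etrans (eqP (tr0 x)); apply: eq_bigr => i _; rewrite hornerXn.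
rewrite -cardE cardF ltnNge => /negP; apply.
apply: leq_trans (size_sum _ _ _) _; apply/bigmax_leqP => i _.
by rewrite size_polyXn ltn_exp2l.
Qed.

Lemma abs_trace_nondegenerate x : (forall y, tr (x * y) = 0) -> x = 0.
Proof.
move=> trx0; apply/eqP/negP => /negP x_neq0; have [y] := abs_trace_neq0.
by rewrite -[y](mulVKf x_neq0) trx0 eqxx.
Qed.

(** Take for [e] a basis over the prime field. By nondegeneracy y is determined by the bits tr (e_i
    y), so by counting every pattern of bits occurs, and f_j realizes the j-th indicator. *)
Lemma abs_trace_dual_bases :
  exists e f : 'I_m -> F, forall i j, tr (e i * f j) = (i == j)%:R.
Proof.
pose L := pPrimeCharType charF.
have dimL : \dim {: L} = m by rewrite pprimeChar_dimf cardF pfactorK.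
pose e (i : 'I_m) : F := (vbasis {: L})`_i.
(* The coordinates are natural numbers, so that additivity of the trace, in the form of
   [abs_traceMn], replaces F_2-linearity. *)
have eP (x : F) : exists c : 'I_m -> nat, x = \sum_i (c i)%:R * e i.
  exists (fun i => nat_of_ord (coord (vbasis {: L}) (cast_ord (esym dimL) i) (x : L) : 'F_2)).
  rewrite {1}(coord_vbasis (memvf (x : L))).
  rewrite (reindex (cast_ord (esym dimL))) /=; first exact: eq_bigr.
  by exists (cast_ord dimL) => i _; rewrite ?cast_ordK ?cast_ordKV.
pose phi (y : F) : {ffun 'I_m -> bool} := [ffun i => tr (e i * y) != 0].
have phi_inj : injective phi.
  move=> y y' /ffunP eqphi; apply/eqP; rewrite -subr_eq0; apply/eqP.
  apply: abs_trace_nondegenerate => x; have [c ->] := eP x.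
  rewrite mulr_sumr abs_trace_sum big1 // => i _.
  rewrite mulrCA abs_traceMn mulrC [_ * e i]mulrC mulrBr.
  rewrite (oppr_pchar2 charF) abs_traceD.
  have := eqphi i; rewrite !ffunE.
  case: (abs_trace01 (e i * y)) => ->; case: (abs_trace01 (e i * y')) => ->;
    by rewrite ?eqxx ?oner_eq0 ?(addrr_pchar2 charF) ?addr0 ?mul0r.
have [psi _ psiK] : bijective phi.
  by apply: inj_card_bij => //; rewrite card_ffun card_bool card_ord cardF.
exists e, (fun j => psi [ffun i => i == j]) => i j.
have /ffunP/(_ i) := psiK [ffun i => i == j]; rewrite !ffunE.
by case: (abs_trace01 (e i * psi [ffun i => i == j])) => ->;
  rewrite ?eqxx ?oner_eq0 => <-.
Qed.

End AbsoluteTrace.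

(** * Bounding totally singular sets *)

(** Vectors are read as (x, y, t) with blocks of lengths nu, nu, delta. The bilinear form is
    deliberately not symmetric: its diagonal is the quadratic form, and its symmetrization is the
    polar form that decides adjacency. *)
Definition hyp_form (R : comNzRingType) (nu delta : nat) (D : 'M[R]_delta)
  (v w : 'rV[R]_(nu + (nu + delta))) : R :=
  (lsubmx v *m (lsubmx (rsubmx w))^T) 0 0
  + (rsubmx (rsubmx v) *m D *m (rsubmx (rsubmx w))^T) 0 0.

Definition anisotropic (R : comNzRingType) (delta : nat) (D : 'M[R]_delta) :=
  forall t : 'rV_delta, (t *m D *m t^T) 0 0 = 0 -> t = 0.

Definition right_vec (R : comNzRingType) (nu delta : nat) (y : 'rV[R]_nu) :
  'rV[R]_(nu + (nu + delta)) := row_mx 0 (row_mx y 0).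

(** Only the product x y involves the second block, so the quadratic form changes by a linear term.
    Counting and lifting singular vectors both adjust the value of the form in this way. *)
Lemma hyp_form_shift (R : comNzRingType) (nu delta : nat) (D : 'M[R]_delta)
  (v : 'rV_(nu + (nu + delta))) (y : 'rV_nu) :
  hyp_form D (v + right_vec delta y) (v + right_vec delta y)
  = hyp_form D v v + (lsubmx v *m y^T) 0 0.
Proof.
have lE : lsubmx (v + right_vec delta y) = lsubmx v.
  by rewrite raddfD /= row_mxKl addr0.
have rE : rsubmx (v + right_vec delta y) = rsubmx v + row_mx y 0.
  by rewrite raddfD /= row_mxKr.
have rlE : lsubmx (rsubmx (v + right_vec delta y)) = lsubmx (rsubmx v) + y.
  by rewrite rE raddfD /= row_mxKl.
have rrE : rsubmx (rsubmx (v + right_vec delta y)) = rsubmx (rsubmx v).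
  by rewrite rE raddfD /= row_mxKr addr0.
rewrite /hyp_form lE rlE rrE raddfD mulmxDr.
by rewrite [X in X + _]mxE addrAC.
Qed.

(** An alternating [N] is S - S^T with S its strict upper triangle, and S and S^T define the same
    quadratic form. This also covers characteristic 2. *)
Lemma alternating_quad (R : comNzRingType) (k : nat) (N : 'M[R]_k) (u : 'rV_k) :
  (forall i, N i i = 0) -> (forall i j, N i j + N j i = 0) ->
  u *m N *m u^T = 0.
Proof.
move=> Nii Nij; pose S : 'M_k := \matrix_(i, j) if (i < j)%N then N i j else 0.
have -> : N = S - S^T.
  apply/matrixP => i j; rewrite !mxE.
  case: (ltngtP i j) => [_|_|/val_inj ->]; rewrite ?subr0 ?sub0r ?Nii //.
  by apply/eqP; rewrite -addr_eq0 Nij.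
rewrite mulmxBr mulmxBl -[u in u *m S^T]trmxK -trmx_mul -trmx_mul mulmxA.
by apply/eqP; rewrite subr_eq0; apply/eqP/rowP => i; rewrite [RHS]mxE !ord1.
Qed.

(** Sylvester's rank inequality for the product of [kermx X], of rank k - rank X, with the matrix
    (X, Z): its first block vanishes. *)
Lemma rank_row_mx_ker (F : fieldType) (k n p : nat) (X : 'M[F]_(k, n))
  (Z : 'M_(k, p)) :
  (\rank (row_mx X Z) <= \rank X + \rank (kermx X *m Z))%N.
Proof.
have := mxrank_mul_min (kermx X) (row_mx X Z).
have := rank_leq_row X; rewrite mxrank_ker mul_mx_row mulmx_ker.
have -> : row_mx 0 (kermx X *m Z) = kermx X *m Z *m row_mx (0 : 'M_(p, n)) 1%:M.
  by rewrite mul_mx_row mulmx0 mulmx1.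
have := mxrankM_maxl (kermx X *m Z) (row_mx (0 : 'M_(p, n)) 1%:M).
by lia.
Qed.

(* Inside the kernel of X the anisotropic coordinates T vanish, so there only Y
   survives, and it is orthogonal to the whole row space of X. *)
Lemma rank_totally_singular (F : fieldType) (k nu delta : nat)
  (D : 'M[F]_delta) (X Y : 'M[F]_(k, nu)) (T : 'M[F]_(k, delta))
  (N := X *m Y^T + T *m D *m T^T) :
  anisotropic D ->
  (forall i, N i i = 0) -> (forall i j, N i j + N j i = 0) ->
  (\rank (row_mx X (row_mx Y T)) <= nu)%N.
Proof.
move=> anisoD Nii Nij; apply: leq_trans (rank_row_mx_ker _ _) _.
have KT0 : kermx X *m T = 0.
  apply/row_matrixP => i; rewrite row0; apply: anisoD.
  have := alternating_quad (row i (kermx X)) Nii Nij.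
  rewrite /N mulmxDr mulmxDl !mulmxA.
  rewrite -row_mul mulmx_ker row0 !mul0mx add0r => /matrixP/(_ 0 0).
  by rewrite row_mul trmx_mul !mulmxA [in RHS]mxE.
have NN0 : N + N^T = 0 by apply/matrixP => i j; rewrite mxE [N^T i j]mxE Nij mxE.
have := congr1 (mulmx (kermx X)) NN0.
rewrite mulmx0 /N !raddfD /= !trmx_mul !trmxK !mulmxA mulmx_ker KT0 !mul0mx.
rewrite !add0r addr0 => /mulmx0_rank_max; rewrite mxrank_tr => rankKY.
rewrite mul_mx_row KT0.
have -> : row_mx (kermx X *m Y) 0 = kermx X *m Y *m row_mx 1%:M (0 : 'M_(nu, delta)).
  by rewrite mul_mx_row mulmx0 mulmx1.
have := mxrankM_maxl (kermx X *m Y) (row_mx 1%:M (0 : 'M_(nu, delta))).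
by lia.
Qed.

Lemma card_sub_rowspace (F : finFieldType) (k d : nat) (C : {set 'rV[F]_d})
  (W : 'M_(k, d)) :
  (forall v, v \in C -> (v <= W)%MS) -> (#|C| <= #|F| ^ \rank W)%N.
Proof.
move=> subCW; pose coordW (v : 'rV_d) := v *m pinvmx (row_base W).
have <- : #|coordW @: C| = #|C|.
  apply: card_in_imset => v w /subCW vW /subCW wW eqvw.
  rewrite -[v](@mulmxKpV _ _ _ _ v (row_base W)) ?eq_row_base //.
  by rewrite -[w](@mulmxKpV _ _ _ _ w (row_base W)) ?eq_row_base // -/(coordW v) eqvw.
by apply: leq_trans (max_card _) _; rewrite card_mx mul1n.
Qed.

(** Stacking the elements of [C] as the rows of [W] makes their Gram matrix the [N] of
    [rank_totally_singular], so [C] lies in a space of dimension at most nu. *)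
Lemma card_totally_singular (F : finFieldType) (nu delta : nat)
  (D : 'M[F]_delta) (C : {set 'rV[F]_(nu + (nu + delta))}) :
  anisotropic D ->
  (forall v, v \in C -> hyp_form D v v = 0) ->
  (forall v w, v \in C -> w \in C -> hyp_form D v w + hyp_form D w v = 0) ->
  (#|C| <= #|F| ^ nu)%N.
Proof.
move=> anisoD C0 CC0.
pose W : 'M_(#|C|, nu + (nu + delta)) := \matrix_i enum_val i.
apply: leq_trans (_ : #|F| ^ \rank W <= _)%N.
  apply: card_sub_rowspace => v vC.
  by rewrite -(enum_rankK_in vC vC) -[enum_val _]rowK row_sub.
rewrite leq_exp2l ?finNzRing_gt1 // -[W]hsubmxK -[rsubmx W]hsubmxK.
have NE i j : (lsubmx W *m (lsubmx (rsubmx W))^T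
    + rsubmx (rsubmx W) *m D *m (rsubmx (rsubmx W))^T) i j
    = hyp_form D (enum_val i) (enum_val j).
  rewrite /hyp_form mxE; congr (_ + _); rewrite !mxE; apply: eq_bigr => l _;
    rewrite !mxE //; congr (_ * _).
  by apply: eq_bigr => l' _; rewrite !mxE.
apply: (rank_totally_singular anisoD) => [i | i j]; rewrite !NE.
  by rewrite C0 ?enum_valP.
by rewrite CC0 ?enum_valP.
Qed.

(** * Counting singular vectors over F_2 *)

Lemma F2_eq1 (c : 'F_2) : c != 0 -> c = 1.
Proof. by case: c => [[|[|c]] c_lt] // _; apply: val_inj. Qed.

(** At least half of the vectors with x nonzero are singular: an injection sends the nonsingular
    ones to singular ones with the same x. *)
Lemma card_singular_left (nu delta : nat) (D : 'M['F_2]_delta) :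
  (2 ^ nu * 2 ^ (nu + delta) - 2 ^ (nu + delta) <=
   #|[set v : 'rV['F_2]_(nu + (nu + delta)) |
        (lsubmx v != 0%R) && (hyp_form D v v == 0%R)]| * 2)%N.
Proof.
set P1 := [set _ | _].
pose P2 := [set v : 'rV['F_2]_(nu + (nu + delta)) |
  (lsubmx v != 0) && (hyp_form D v v != 0)].
pose Z := [set v : 'rV['F_2]_(nu + (nu + delta)) | lsubmx v == 0].
have cardZ : (#|Z| <= 2 ^ (nu + delta))%N.
  have -> : (2 ^ (nu + delta))%N = #|{: 'rV['F_2]_(nu + delta)}|.
    by rewrite card_mx mul1n card_Fp.
  apply: leq_trans (leq_imset_card (fun w => row_mx 0 w) _).
  apply: subset_leq_card; apply/subsetP => v; rewrite inE => /eqP v0.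
  by apply/imsetP; exists (rsubmx v); rewrite // -v0 hsubmxK.
have cardP2 : (#|P2| <= #|P1|)%N.
  (* Where x_i = 1, adding the i-th unit vector to y changes the form by 1. The shift depends on x
     alone, which [flip] preserves, hence injectivity. *)
  pose e (x : 'rV['F_2]_nu) : 'rV['F_2]_nu :=
    if [pick i | x 0 i != 0] is Some i then delta_mx 0 i else 0.
  pose flip (v : 'rV['F_2]_(nu + (nu + delta))) := v + right_vec delta (e (lsubmx v)).
  have lflip v : lsubmx (flip v) = lsubmx v.
    by rewrite /flip raddfD /= row_mxKl addr0.
  have flip_inj : injective flip.
    move=> v w eqvw; have := eqvw; rewrite /flip.
    by rewrite -(lflip w) -eqvw lflip => /addIr.
  rewrite -(card_imset _ flip_inj); apply: subset_leq_card.
  apply/subsetP => _ /imsetP[v + ->]; rewrite !inE lflip => /andP[v0 Qv].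
  rewrite v0 hyp_form_shift (F2_eq1 Qv) /e; case: pickP => [i vi|vi0].
    by rewrite trmx_delta -colE mxE (F2_eq1 vi).
  case/eqP: v0; apply/rowP => i; rewrite [RHS]mxE; apply/eqP.
  by have := vi0 i; move/negbFE.
have <- : (#|P1| + #|P2| + #|Z| = 2 ^ nu * 2 ^ (nu + delta))%N.
  have <- : #|{: 'rV['F_2]_(nu + (nu + delta))}| = (2 ^ nu * 2 ^ (nu + delta))%N.
    by rewrite card_mx mul1n card_Fp // expnD.
  have P12 : P1 :&: P2 = set0.
    apply/setP => v; rewrite !inE.
    by case: (hyp_form D v v == 0); rewrite ?andbF.
  have P12Z : (P1 :|: P2) :&: Z = set0.
    by apply/setP => v; rewrite !inE; case: (lsubmx v == 0); rewrite ?andbF.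
  rewrite -cardsT -(cardsUI P1 P2) P12 cards0 addn0 -cardsUI P12Z cards0 addn0.
  congr #|pred_of_set _|.
  apply/setP => v; rewrite !inE.
  by case: (hyp_form D v v == 0); case: (lsubmx v == 0).
by lia.
Qed.

(** The vectors (0, y, 0) with y nonzero account for the summand 1 of the second factor, those with
    x nonzero for the power of 2. *)
Lemma card_singular (nu delta : nat) (D : 'M['F_2]_delta) : (0 < nu)%N ->
  ((2 ^ nu - 1) * (2 ^ (nu + delta - 1) + 1) <=
   #|[set v : 'rV['F_2]_(nu + (nu + delta)) |
        (v != 0%R) && (hyp_form D v v == 0%R)]|)%N.
Proof.
move=> nu_gt0.
have := card_singular_left nu D; set P1 := [set v | _ & _] => cardP1.
pose P0 := right_vec delta @: [set~ (0 : 'rV['F_2]_nu)].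
have cardP0 : #|P0| = (2 ^ nu - 1)%N.
  rewrite card_imset => [|y y' /eq_row_mx[_ /eq_row_mx[]] //].
  by rewrite cardsC1 card_mx mul1n card_Fp // subn1.
apply: leq_trans (_ : #|P0 :|: P1| <= _)%N.
  rewrite cardsU; have -> : P0 :&: P1 = set0.
    apply/setP => v; rewrite !inE; apply/negP => /andP[/imsetP[y _ ->]].
    by rewrite row_mxKl eqxx.
  rewrite cards0 subn0 cardP0.
  have powE : (2 ^ (nu + delta) = 2 * 2 ^ (nu + delta - 1))%N.
    by rewrite -expnS; congr expn; lia.
  move: cardP1; rewrite powE mulnCA -mulnBr [(2 * _)%N]mulnC leq_pmul2r // => leP1.
  by rewrite mulnDr muln1 [leqLHS]addnC leq_add2l mulnBl ?mul1n.
apply: subset_leq_card; apply/subsetP => v; rewrite !inE => /orP[|].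
  case/imsetP => y; rewrite !inE => y0 ->; apply/andP; split.
    apply: contra_neq y0 => /(congr1 rsubmx)/(congr1 lsubmx).
    by rewrite row_mxKr row_mxKl !raddf0.
  have := hyp_form_shift D 0 y; rewrite add0r => ->.
  by rewrite /hyp_form !raddf0 /= !mul0mx !mxE !addr0.
case/andP=> v0 ->; rewrite andbT; apply: contra_neq v0 => ->.
by rewrite raddf0.
Qed.

Lemma card_leq_fibers (T : finType) (P : {set T}) (g : T -> nat) (k b : nat) :
  (forall v, v \in P -> (g v < k)%N) ->
  (forall c, (#|[set v in P | g v == c]| <= b)%N) -> (#|P| <= k * b)%N.
Proof.
elim: k P => [|k IHk] P ltgk leb.
  rewrite leqn0 cards_eq0; apply/eqP/setP => v; rewrite inE.
  by apply/negP => /ltgk.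
rewrite mulSn -(cardsID [set v | g v == k] P); apply: leq_add.
  by apply: leq_trans (leb k); rewrite setIdE.
apply: IHk => [v | c].
  by rewrite !inE => /andP[gv /ltgk]; rewrite ltnS leq_eqVlt (negPf gv).
apply: leq_trans (leb c); apply: subset_leq_card; apply/subsetP => v.
by rewrite !inE => /andP[/andP[_ ->]].
Qed.

(** * Reduction of Z/2^n modulo 2 *)

(** For n = 0 the type ['Z_(2 ^ n)] has two elements, so the modulus is even there too and reduction
    is a ring morphism for every n. *)
Lemma even_Zp_modulus (n : nat) : (2 %| (Zp_trunc (2 ^ n)).+2)%N.
Proof. by case: n => [|n] //; rewrite Zp_cast ?(ltn_exp2l 0) // expnS dvdn_mulr. Qed.

(** The target is F_2 for the lower bound and a larger field for the colorings. Carrying [charR] as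
    an argument lets the morphism instances be inferred. *)
Definition redZ (R : nzRingType) (charR : 2%N \in [pchar R]) (n : nat)
  (x : 'Z_(2 ^ n)) : R := (x : nat)%:R.

Section ReductionModTwo.

Variables (R : nzRingType) (charR : 2%N \in [pchar R]) (n : nat).

Local Notation red := (@redZ R charR n).

Lemma natr_mod_even (d k : nat) : (2 %| d)%N -> (k %% d)%:R = k%:R :> R.
Proof.
rewrite (dvdn_pcharf charR) => /eqP d0.
by rewrite [in RHS](divn_eq k d) natrD natrM d0 mulr0 add0r.
Qed.

Lemma redZ_nat (k : nat) : red k%:R = k%:R.
Proof. by rewrite /redZ Zp_nat /= natr_mod_even // even_Zp_modulus. Qed.

Lemma redZ_is_zmod_morphism : zmod_morphism red.
Proof.
have redD x y : red (x + y) = red x + red y.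
  by rewrite /redZ /= natr_mod_even ?even_Zp_modulus // natrD.
by move=> x y; apply/eqP; rewrite eq_sym subr_eq -redD subrK.
Qed.

HB.instance Definition _ :=
  GRing.isZmodMorphism.Build 'Z_(2 ^ n) R red redZ_is_zmod_morphism.

Lemma redZ_is_monoid_morphism : monoid_morphism red.
Proof.
split=> [|x y]; first by rewrite -[1]/(1%:R) redZ_nat.
by rewrite /redZ /= natr_mod_even ?even_Zp_modulus // natrM.
Qed.

HB.instance Definition _ :=
  GRing.isMonoidMorphism.Build 'Z_(2 ^ n) R red redZ_is_monoid_morphism.

Lemma redZ_odd (x : 'Z_(2 ^ n)) : red x = (odd x)%:R.
Proof. by rewrite /redZ -[in RHS]modn2 natr_mod_even. Qed.

Lemma unit_redZ (x : 'Z_(2 ^ n)) :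
  (0 < n)%N -> (x \is a GRing.unit) = (red x != 0).
Proof.
move=> n_gt0; rewrite -[x in LHS]natr_Zp unitZpE ?(ltn_exp2l 0) //.
rewrite coprime_pexpl // coprime2n redZ_odd.
by case: odd; rewrite ?oner_eq0 ?eqxx.
Qed.

Lemma redZ_unit (x : 'Z_(2 ^ n)) :
  (0 < n)%N -> x \is a GRing.unit -> red x = 1.
Proof.
move=> n_gt0; rewrite unit_redZ // redZ_odd.
by case: odd; rewrite ?eqxx.
Qed.

End ReductionModTwo.

(** * The Gram matrix in block form and its residue *)

Definition tail_mx (n delta : nat) (z : 'Z_(2 ^ n)) : 'M['Z_(2 ^ n)]_delta :=
  \matrix_(i, j)
    (if i == j then (if delta == 1%N then 1 else z)
     else if [&& delta == 2%N, i == 0%N :> nat & j == 1%N :> nat] then 1 else 0).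

Lemma split_dim (nu delta : nat) : (2 * nu + delta = nu + (nu + delta))%N.
Proof. by rewrite mul2n -addnn addnA. Qed.

Definition split_vec (R : Type) (nu delta : nat) (a : 'rV[R]_(2 * nu + delta)) :
  'rV[R]_(nu + (nu + delta)) := castmx (erefl, split_dim nu delta) a.

Lemma castmx_quad (R : nzRingType) (m p : nat) (e : m = p) (a b : 'rV[R]_m)
  (G : 'M_m) :
  a *m G *m b^T
  = castmx (erefl, e) a *m castmx (e, e) G *m (castmx (erefl, e) b)^T.
Proof. by case: p / e; rewrite !castmx_id. Qed.

Lemma Gmat_block (n nu delta : nat) (z : 'Z_(2 ^ n)) :
  castmx (split_dim nu delta, split_dim nu delta) (Gmat nu delta z)
  = block_mx 0 (row_mx 1%:M 0) 0 (block_mx 0 0 0 (tail_mx delta z)).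
Proof.
apply/matrixP => i j; rewrite castmxE mxE /=.
have [i' ->|i' ->] := split_ordP i; have [j' ->|j' ->] := split_ordP j;
  rewrite ?block_mxEul ?block_mxEur ?block_mxEdl ?block_mxEdr /=.
- rewrite [RHS]mxE; have := ltn_ord i'; have := ltn_ord j' => jlt ilt.
  do ![case: ifP => //]; lia.
- have [k ->|k ->] := split_ordP j'; rewrite ?row_mxEl ?row_mxEr [RHS]mxE /=.
    have := ltn_ord i'; have := ltn_ord k => jlt ilt.
    rewrite [(nu + k)%N]addnC eqn_add2r val_eqE eq_sym.
    case: eqP => //= _; case: ifP; first by lia.
    by move=> _; case: ifP => //; lia.
  have := ltn_ord i'; have := ltn_ord k => jlt ilt.
  by do ![case: ifP => //]; lia.
- rewrite [RHS]mxE; have := ltn_ord i'; have := ltn_ord j' => jlt ilt.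
  do ![case: ifP => //]; lia.
have := ltn_ord i'; have := ltn_ord j' => jlt ilt.
have [k Ek|k Ek] := split_ordP i'; have [l El|l El] := split_ordP j';
  rewrite Ek El ?block_mxEul ?block_mxEur ?block_mxEdl ?block_mxEdr ?[RHS]mxE /=;
  have := ltn_ord k; have := ltn_ord l => llt klt;
  try by do ![case: ifP => //]; lia.
rewrite !eqn_add2l val_eqE.
have -> : (2 * nu <= nu + (nu + k))%N by lia.
by have -> : ((nu + (nu + l) == (2 * nu).+1) = (l == 1 :> nat))%N by lia.
Qed.

Lemma Gmat_hyp_form (n nu delta : nat) (z : 'Z_(2 ^ n))
  (a b : 'rV['Z_(2 ^ n)]_(2 * nu + delta)) :
  (a *m Gmat nu delta z *m b^T) 0 0
  = hyp_form (tail_mx delta z) (split_vec a) (split_vec b).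
Proof.
rewrite (castmx_quad (split_dim nu delta)) Gmat_block -!/(split_vec _).
rewrite /hyp_form -[split_vec a in LHS]hsubmxK -[split_vec b in LHS]hsubmxK.
rewrite -[rsubmx (split_vec a) in LHS]hsubmxK.
rewrite -[rsubmx (split_vec b) in LHS]hsubmxK.
rewrite mul_row_block !mulmx0 addr0 mul_mx_row mulmx1 mulmx0 mul_row_block.
rewrite !mulmx0 !add0r add_row_mx addr0 add0r.
by rewrite !tr_row_mx !mul_row_col mul0mx add0r mxE.
Qed.

Lemma hyp_form_map (R S : comNzRingType) (f : {rmorphism R -> S})
  (nu delta : nat) (D : 'M[R]_delta) (v w : 'rV[R]_(nu + (nu + delta))) :
  hyp_form (map_mx f D) (map_mx f v) (map_mx f w) = f (hyp_form D v w).
Proof.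
by rewrite /hyp_form -!map_lsubmx -!map_rsubmx -!map_lsubmx !map_trmx
  -!map_mxM !mxE rmorphD.
Qed.

Lemma polar_hyp_form (n nu delta : nat) (z : 'Z_(2 ^ n))
  (a b : 'rV['Z_(2 ^ n)]_(2 * nu + delta)) :
  (a *m (Gmat nu delta z + (Gmat nu delta z)^T) *m b^T) 0 0
  = hyp_form (tail_mx delta z) (split_vec a) (split_vec b)
    + hyp_form (tail_mx delta z) (split_vec b) (split_vec a).
Proof.
rewrite -!Gmat_hyp_form mulmxDr mulmxDl mxE; congr (_ + _).
by rewrite -[in LHS](trmxK a) -!trmx_mul mulmxA mxE.
Qed.

(** For delta at most 2 this is the residue of Delta, the unit z becoming 1. For delta = 2 it gives
    t0^2 + t0 t1 + t1^2, the norm form of GF(4) over F_2. *)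
Definition tail2_mx (R : nzRingType) (delta : nat) : 'M[R]_delta :=
  \matrix_(i, j) (i <= j)%N%:R.

Lemma map_tail_mx (R : nzRingType) (charR : 2%N \in [pchar R]) (n delta : nat)
  (z : 'Z_(2 ^ n)) :
  (0 < n)%N -> (delta <= 2)%N -> z \is a GRing.unit ->
  map_mx (redZ charR (n := n)) (tail_mx delta z) = tail2_mx R delta.
Proof.
move=> n_gt0 delta_le2 z_unit; apply/matrixP => i j; rewrite !mxE.
have [->|i_neq_j] := eqVneq i j.
  by rewrite leqnn; case: ifP; rewrite ?rmorph1 ?redZ_unit.
have -> : [&& delta == 2%N, i == 0%N :> nat & j == 1%N :> nat] = (i <= j)%N.
  by have := ltn_ord i; have := ltn_ord j; move: i_neq_j; rewrite -val_eqE /=; lia.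
by case: ifP => _; rewrite ?rmorph1 ?rmorph0.
Qed.

Lemma tail2_form1 (R : nzRingType) (t u : 'rV[R]_1) :
  (t *m tail2_mx R 1 *m u^T) 0 0 = t 0 0 * u 0 0.
Proof. by rewrite !mxE big_ord1 !mxE big_ord1 !mxE mulr1. Qed.

Lemma tail2_form2 (R : nzRingType) (t u : 'rV[R]_2) :
  (t *m tail2_mx R 2 *m u^T) 0 0
  = t 0 0 * u 0 0 + t 0 0 * u 0 1 + t 0 1 * u 0 1.
Proof.
rewrite mxE !big_ord_recl big_ord0 !mxE !big_ord_recl !big_ord0 !mxE /=.
rewrite !mulr1 !mulr0 !addr0 mulrDl addrA.
by have -> : lift 0 0 = 1 :> 'I_2 by apply: val_inj.
Qed.

Lemma anisotropic_tail2 (delta : nat) :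
  (delta <= 2)%N -> anisotropic (tail2_mx 'F_2 delta).
Proof.
case: delta => [|[|[|//]]] _ t; first by move=> _; apply/rowP => -[].
  rewrite tail2_form1 => /eqP; rewrite mulf_eq0 orbb => /eqP t0.
  by apply/rowP => i; rewrite ord1 t0 mxE.
rewrite tail2_form2 => Qt.
suff [t0 t1] : t 0 0 = 0 /\ t 0 1 = 0.
  apply/rowP => i; rewrite [RHS]mxE; case: i => [[|[|//]] ilt].
    by rewrite -[RHS]t0; congr (t _ _); apply: val_inj.
  by rewrite -[RHS]t1; congr (t _ _); apply: val_inj.
have [t00|/F2_eq1 t01] := eqVneq (t 0 0) 0;
  have [t10|/F2_eq1 t11] := eqVneq (t 0 1) 0 => //; move: Qt.
- by rewrite t00 t11 !mul0r !add0r mulr1 => /eqP; rewrite oner_eq0.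
- by rewrite t01 t10 !mulr0 !addr0 mulr1 => /eqP; rewrite oner_eq0.
by rewrite t01 t11.
Qed.

(** * Lifting singular vectors and the lower bound *)

Definition charF2 : 2%N \in [pchar 'F_2] := pchar_Fp (isT : prime 2).

Lemma lift_singular (n nu delta : nat) (D : 'M['Z_(2 ^ n)]_delta)
  (red := redZ charF2 (n := n)) (v : 'rV['F_2]_(nu + (nu + delta))) :
  anisotropic (map_mx red D) -> hyp_form (map_mx red D) v v = 0 ->
  exists2 a, map_mx red a = v & hyp_form D a a = 0.
Proof.
move=> anisoD Qv; pose s (c : 'F_2) : 'Z_(2 ^ n) := (c : nat)%:R.
have sK c : red (s c) = c by rewrite /red redZ_nat natr_Zp.
have map_sK : map_mx red (map_mx s v) = v by apply/rowP => i; rewrite !mxE sK.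
have [v0|/rV0Pn] := eqVneq (lsubmx v) 0.
  (* With x = 0 anisotropy forces t = 0, and the coordinatewise lift of (0, y, 0) is already
     singular. *)
  have t0 : rsubmx (rsubmx v) = 0.
    by apply: anisoD; move: Qv; rewrite /hyp_form v0 mul0mx [X in X + _]mxE add0r.
  exists (map_mx s v) => //.
  rewrite /hyp_form -!map_lsubmx -!map_rsubmx t0 v0.
  have map_s0 p : map_mx s (0 : 'rV_p) = 0 by apply/rowP => i; rewrite !mxE.
  by rewrite !map_s0 !mul0mx !mxE addr0.
case=> i vi; pose c := hyp_form D (map_mx s v) (map_mx s v).
(* The lift of x_i = 1 is exactly 1, so subtracting [c] from y_i cancels the value [c]; as [c]
   reduces to 0, the residue is still [v]. *)
exists (map_mx s v + right_vec delta (- c *: delta_mx 0 i)).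
  have redc : red c = 0 by rewrite /c /red -hyp_form_map -/red map_sK.
  rewrite map_mxD map_sK /right_vec !map_row_mx !raddf0 map_mxZ rmorphN.
  by rewrite [X in - X]redc oppr0 scale0r !row_mx0 addr0.
rewrite hyp_form_shift -/c linearZ /= trmx_delta -scalemxAr -colE mxE mxE.
by rewrite -map_lsubmx mxE (F2_eq1 vi) /s mulr1 subrr.
Qed.

Lemma unimodular_redZ (n m : nat) (a : 'rV['Z_(2 ^ n)]_m) :
  (0 < n)%N -> map_mx (redZ charF2 (n := n)) a != 0 -> unimodular a.
Proof.
move=> n_gt0 a_neq0; apply/existsP; apply/existsP; apply: contra_neqT a_neq0.
rewrite negb_exists => /forallP a0; apply/rowP => i; rewrite !mxE.
by have := a0 i; rewrite (unit_redZ charF2) // => /negbNE/eqP.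
Qed.

Lemma vclass_refl (n m : nat) (a : 'rV['Z_(2 ^ n)]_m) : a \in vclass a.
Proof. by rewrite inE; apply/existsP; exists 1; rewrite unitr1 scale1r eqxx. Qed.

Lemma orth_colorable_lower_bound (n nu delta k : nat) (z : 'Z_(2 ^ n)) :
  (0 < n)%N -> (0 < nu)%N -> (delta <= 2)%N -> z \is a GRing.unit ->
  orth_colorable nu delta z k -> (2 ^ (nu + delta - 1) + 1 <= k)%N.
Proof.
move=> n_gt0 nu_gt0 delta_le2 z_unit [f [f_lt f_adj]].
pose red := redZ charF2 (n := n).
have DE := map_tail_mx charF2 n_gt0 delta_le2 z_unit.
have anisoD := anisotropic_tail2 delta_le2.
set D := tail2_mx _ _ in DE anisoD.
pose P := [set v : 'rV['F_2]_(nu + (nu + delta)) |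
  (v != 0) && (hyp_form D v v == 0)].
pose lift_of v := odflt 0 [pick a : 'rV['Z_(2 ^ n)]_(2 * nu + delta) |
  (map_mx red (split_vec a) == v)
    && (hyp_form (tail_mx delta z) (split_vec a) (split_vec a) == 0)].
have liftP v : v \in P -> map_mx red (split_vec (lift_of v)) = v /\
    hyp_form (tail_mx delta z) (split_vec (lift_of v)) (split_vec (lift_of v)) = 0.
  rewrite inE => /andP[_ /eqP Qv]; rewrite /lift_of; case: pickP => [a|].
    by case/andP => /eqP-> /eqP->.
  rewrite -DE in anisoD Qv.
  have [a redaE Qa] := lift_singular anisoD Qv.
  move=> /(_ (castmx (erefl, esym (split_dim nu delta)) a)).
  by rewrite /split_vec castmxKV redaE Qa !eqxx.
have lift_vertex v : v \in P -> vclass (lift_of v) \in orth_vertices nu delta z.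
  move=> Pv; have [redE Qv] := liftP v Pv; apply: imset_f.
  rewrite inE Gmat_hyp_form Qv eqxx andbT; apply: unimodular_redZ => //.
  move: Pv; rewrite inE => /andP[v_neq0 _]; apply: contra_neq v_neq0.
  by rewrite -{2}redE /split_vec map_castmx => ->; rewrite castmx_const.
pose g v := f (vclass (lift_of v)).
have : (#|P| <= k * (2 ^ nu - 1))%N.
  apply: (card_leq_fibers (g := g)) => [v /lift_vertex|c]; first exact: f_lt.
  set C := [set v in P | g v == c].
  (* Adjoining 0 to the color class improves its bound from 2^nu to 2^nu - 1, the factor that
     cancels at the end. *)
  have C0 : 0 \notin C by rewrite !inE eqxx.
  rewrite -(leq_add2l 1) subnKC ?expn_gt0 //.
  have -> : (1 + #|C| = #|0%R |: C|)%N by rewrite cardsU1 C0.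
  have hyp0 v : hyp_form D 0 v = 0.
    by rewrite /hyp_form !raddf0 !mul0mx !mxE addr0.
  have hyp0r v : hyp_form D v 0 = 0.
    by rewrite /hyp_form !raddf0 !mxE addr0.
  rewrite -[X in (_ <= X ^ _)%N](@card_Fp 2) //.
  apply: (card_totally_singular anisoD) => [v|v w].
    by case/setU1P => [->//|]; rewrite !inE => /andP[/andP[_ /eqP]].
  case/setU1P => [->|]; first by rewrite hyp0 hyp0r addr0.
  rewrite inE => /andP[Pv /eqP gv].
  case/setU1P => [->|]; first by rewrite hyp0 hyp0r addr0.
  rewrite inE => /andP[Pw /eqP gw].
  have [redv _] := liftP v Pv; have [redw _] := liftP w Pw.
  rewrite -{1 2}redv -{1 2}redw -DE !hyp_form_map -rmorphD -polar_hyp_form.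
  apply/eqP/negPn; rewrite -unit_redZ //; apply/negP => vw_unit.
  apply: (f_adj _ _ (lift_vertex v Pv) (lift_vertex w Pw)); last first.
    by rewrite -/(g v) -/(g w) gv gw.
  apply/existsP; exists (lift_of v); rewrite vclass_refl.
  by apply/existsP; exists (lift_of w); rewrite vclass_refl.
move=> /(leq_trans (card_singular D nu_gt0)).
by rewrite mulnC leq_pmul2r // subn_gt0 (ltn_exp2l 0).
Qed.

(** * Colorings by lines over a finite field *)

(** A class is colored through a chosen representative, and invariance under units makes the choice
    harmless. The default 0 is not reached, as vertices are nonempty. *)
Lemma orth_colorable_by (n nu delta : nat) (z : 'Z_(2 ^ n)) (K : finType)
  (col : 'rV['Z_(2 ^ n)]_(2 * nu + delta) -> K) :
  (forall l a, l \is a GRing.unit -> col (l *: a) = col a) ->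
  (forall a b, (a *m Gmat nu delta z *m a^T) 0 0 = 0 ->
     (b *m Gmat nu delta z *m b^T) 0 0 = 0 -> col a = col b ->
     (a *m (Gmat nu delta z + (Gmat nu delta z)^T) *m b^T) 0 0
       \isn't a GRing.unit) ->
  orth_colorable nu delta z #|K|.
Proof.
move=> colZ col_proper.
pose f (A : {set 'rV['Z_(2 ^ n)]_(2 * nu + delta)}) :=
  enum_rank (col (odflt 0 [pick a in A])).
have vertexP A a : A \in orth_vertices nu delta z -> a \in A ->
    (a *m Gmat nu delta z *m a^T) 0 0 = 0 /\ f A = enum_rank (col a).
  case/imsetP => a0; rewrite inE => /andP[_ /eqP Qa0] ->.
  have classP b : b \in vclass a0 -> exists2 l, l \is a GRing.unit & b = l *: a0.
    by rewrite inE => /existsP[l /andP[l_unit /eqP->]]; exists l.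
  move=> aA; have [l l_unit ->] := classP a aA; split.
    by rewrite linearZ /= -scalemxAr -!scalemxAl scalerA mxE Qa0 mulr0.
  rewrite /f colZ //; case: pickP => [b /classP[l' l'_unit ->]|/(_ a)].
    by rewrite /= colZ.
  by rewrite aA.
exists (fun A => nat_of_ord (f A)); split=> [A _|A B VA VB]; first exact: ltn_ord.
case/existsP => a /andP[aA /existsP[b /andP[bB ab_unit]]].
have [Qa ->] := vertexP A a VA aA; have [Qb ->] := vertexP B b VB bB.
move=> /val_inj/enum_rank_inj eqab.
by have := col_proper a b Qa Qb eqab; rewrite ab_unit.
Qed.

Section TraceColorings.

Variables (n m : nat) (F : finFieldType).
Hypotheses (n_gt0 : (0 < n)%N) (charF : 2%N \in [pchar F]).
Hypothesis cardF : #|F| = (2 ^ m)%N.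

Local Notation red := (redZ charF (n := n)).
Local Notation tr := (@abs_trace F m).

Definition field_coord (e : 'I_m -> F) (g : 'rV['Z_(2 ^ n)]_m) : F :=
  \sum_i red (g 0 i) * e i.

(** Using [e] on one side and its dual [f] on the other turns the dot product modulo 2 into the
    trace form of [F]. *)
Lemma trace_field_coord (e f : 'I_m -> F) (g h : 'rV['Z_(2 ^ n)]_m) :
  (forall i j, tr (e i * f j) = (i == j)%:R) ->
  tr (field_coord e g * field_coord f h) = red ((g *m h^T) 0 0).
Proof.
move=> dual; rewrite /field_coord mulr_suml (abs_trace_sum _ charF).
rewrite mxE rmorph_sum; apply: eq_bigr => i _; rewrite -mulrA abs_traceMn //.
rewrite [e i * _]mulr_sumr (abs_trace_sum _ charF) mxE rmorphM; congr (_ * _).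
rewrite (bigD1 i) //= mulrCA abs_traceMn // dual eqxx mulr1.
rewrite big1 ?addr0 // => j /negPf j_neq_i.
by rewrite mulrCA abs_traceMn // dual eq_sym j_neq_i mulr0.
Qed.

Lemma field_coordZ (e : 'I_m -> F) (l : 'Z_(2 ^ n)) (g : 'rV['Z_(2 ^ n)]_m) :
  l \is a GRing.unit -> field_coord e (l *: g) = field_coord e g.
Proof.
move=> l_unit; apply: eq_bigr => i _.
by rewrite mxE rmorphM [X in X * _ * _](redZ_unit charF n_gt0 l_unit) mul1r.
Qed.

(** The color is the slope y / x, with [None] for infinity. Equal slopes give x_b y_a = x_a y_b, so
    the two traces in the polar form cancel. *)
Lemma symplectic_colorable (nu delta : nat) (z : 'Z_(2 ^ n))
  (X Y : 'rV['Z_(2 ^ n)]_(2 * nu + delta) -> 'rV['Z_(2 ^ n)]_m) :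
  (forall l a, X (l *: a) = l *: X a) -> (forall l a, Y (l *: a) = l *: Y a) ->
  (forall a b,
     red ((a *m (Gmat nu delta z + (Gmat nu delta z)^T) *m b^T) 0 0)
     = red ((X a *m (Y b)^T) 0 0) + red ((X b *m (Y a)^T) 0 0)) ->
  orth_colorable nu delta z (2 ^ m + 1).
Proof.
move=> XZ YZ polarE; have [e [f dual]] := abs_trace_dual_bases charF cardF.
pose x a := field_coord e (X a); pose y a := field_coord f (Y a).
have -> : (2 ^ m + 1 = #|{: option F}|)%N by rewrite card_option cardF addn1.
apply: (@orth_colorable_by _ _ _ _ _
  (fun a => if x a == 0 then None else Some (y a / x a))) => [l a l_unit|].
  by rewrite /x /y XZ YZ !field_coordZ.
move=> a b _ _ eqab; rewrite (unit_redZ charF) // negbK polarE.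
rewrite -!(trace_field_coord _ _ dual) -/(x a) -/(y a) -/(x b) -/(y b).
move: eqab; have [-> | xa0] := eqVneq (x a) 0.
  by have [-> | //] := eqVneq (x b) 0; rewrite !mul0r !abs_trace0 ?addr0.
have [// | xb0] := eqVneq (x b) 0; case=> yx.
have -> : x b * y a = x a * y b.
  by rewrite -[y a](divfK xa0) yx mulrA [x b * _]mulrC divfK // mulrC.
by rewrite (addrr_pchar2 charF).
Qed.

(** * Kantor's orthogonal spread *)

Hypothesis m_odd : odd m.

(* Kantor's orthogonal spread: the subspaces {(x, a, kerdock_map s x a)} for s in F,
   together with {x = a = 0}, partition the singular vectors of the quadratic form
   tr (x y) + a b on F + F_2 + F + F_2. *)
Definition kerdock_map (s x a : F) : F * F :=
  (x * s ^+ 2 + s * tr (x * s) + a * s, tr (x * s)).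

Local Notation bit c := (c ^+ 2 = c).

Lemma abs_trace_bitM (c x : F) : bit c -> tr (c * x) = c * tr x.
Proof. by case/idem01 => ->; rewrite ?mul0r ?mul1r ?abs_trace0. Qed.

Lemma bit_tr (x : F) : bit (tr x).
Proof. exact: sqr_abs_trace. Qed.

Lemma two_eq0 : 2%:R = 0 :> F.
Proof. exact: pcharf0 charF. Qed.

(** Once bits are pulled out of the traces, every term occurs twice. *)
Lemma kerdock_polar (s x a x' a' : F) : bit a -> bit a' ->
  tr (x * (kerdock_map s x' a').1) + a * (kerdock_map s x' a').2
  + (tr (x' * (kerdock_map s x a).1) + a' * (kerdock_map s x a).2) = 0.
Proof.
move=> bita bita' /=; rewrite !mulrDr !(abs_traceD _ charF).
have -> : x' * (x * s ^+ 2) = x * (x' * s ^+ 2) by rewrite mulrCA.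
have -> : x * (s * tr (x' * s)) = tr (x' * s) * (x * s) by ring.
have -> : x' * (s * tr (x * s)) = tr (x * s) * (x' * s) by ring.
have -> : x * (a' * s) = a' * (x * s) by ring.
have -> : x' * (a * s) = a * (x' * s) by ring.
rewrite !(abs_trace_bitM _ (bit_tr _)) !(abs_trace_bitM _ bita) (abs_trace_bitM _ bita').
set A := tr (x * (x' * s ^+ 2)); set B := tr (x * s); set C := tr (x' * s).
by transitivity (2%:R * (A + B * C + a * C + a' * B)); [ring | rewrite two_eq0 mul0r].
Qed.

(** Both tr (x^2 s^2) and tr (x s)^2 equal tr (x s), so the terms cancel in pairs. *)
Lemma kerdock_singular (s x a : F) : bit a ->
  tr (x * (kerdock_map s x a).1) + a * (kerdock_map s x a).2 = 0.
Proof.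
move=> bita /=; rewrite !mulrDr !(abs_traceD _ charF).
have -> : tr (x * (x * s ^+ 2)) = tr (x * s).
  by rewrite -[RHS](abs_trace_sqr cardF); congr abs_trace; ring.
have -> : x * (s * tr (x * s)) = tr (x * s) * (x * s) by ring.
have -> : x * (a * s) = a * (x * s) by ring.
rewrite (abs_trace_bitM _ (bit_tr _)) (abs_trace_bitM _ bita) -expr2 bit_tr.
by transitivity (2%:R * (tr (x * s) + a * tr (x * s))); [ring | rewrite two_eq0 mul0r].
Qed.

(** With c = tr (x s) = tr (x t), dividing the equality of first components by s + t leaves x (s +
    t) = c + a. The left side has trace 0 and the right side is its own trace, so both vanish; hence
    x = 0, then c = 0 and a = 0. *)
Lemma kerdock_inj (s t x a : F) : bit a -> (x != 0) || (a != 0) ->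
  kerdock_map s x a = kerdock_map t x a -> s = t.
Proof.
move=> bita xa0 [eq1 eq2]; apply/eqP/negPn/negP => s_neq_t.
rewrite -eq2 in eq1; set c := tr (x * s) in eq1 eq2.
have bitc : bit c by exact: bit_tr.
have st_neq0 : s + t != 0 by rewrite addr_eq0 (oppr_pchar2 charF).
have xst : x * (s + t) + (c + a) = 0.
  apply: (mulfI st_neq0); rewrite mulr0.
  transitivity (x * s ^+ 2 + s * c + a * s + (x * t ^+ 2 + t * c + a * t)
    + 2%:R * (x * s * t)); first by ring.
  by rewrite eq1 (addrr_pchar2 charF) two_eq0 mul0r addr0.
(* Oddness of [m] enters here, through tr 1 = m = 1. *)
have trca (b : F) : bit b -> tr b = b.
  move=> bitb; rewrite -[b in LHS]mulr1 abs_trace_bitM // abs_trace1.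
  by rewrite -(natr_mod_even charF m (dvdnn 2)) modn2 m_odd mulr1.
have ca0 : c + a = 0.
  have /(congr1 tr) := xst; rewrite !(abs_traceD _ charF) abs_trace0 mulrDr.
  by rewrite (abs_traceD _ charF) -/c -eq2 (addrr_pchar2 charF) add0r !trca.
move: xst; rewrite ca0 addr0 => /eqP; rewrite mulf_eq0 (negPf st_neq0) orbF.
move=> /eqP x0; move: xa0; rewrite x0 eqxx /=.
by move: ca0; rewrite /c x0 mul0r abs_trace0 add0r => ->; rewrite eqxx.
Qed.

(* By [kerdock_inj] it is enough to bound the number of singular vectors above
   (x, a) by #|F|; y0 serves to recover y from y + b y0 when a = 0. *)
Lemma kerdock_surj (x a y b : F) : bit a -> bit b -> (x != 0) || (a != 0) ->
  tr (x * y) + a * b = 0 -> exists s, kerdock_map s x a = (y, b).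
Proof.
move=> bita bitb xa0 Qxy.
pose S := [set p : F * F | (p.2 ^+ 2 == p.2) && (tr (x * p.1) + a * p.2 == 0)].
have cardS : (#|S| <= #|F|)%N.
  have [y0 y0P] : exists y0, a = 0 -> tr (x * y0) = 1.
    have [a0 | /negPf a0F] := eqVneq a 0; last by exists 0 => /eqP; rewrite a0F.
    move: xa0; rewrite a0 eqxx orbF => x0.
    have [w trw] := abs_trace_neq0 cardF; exists (x^-1 * w) => _.
    by rewrite mulrA mulfV // mul1r; case: (abs_trace01 charF cardF w) trw => ->;
      rewrite ?eqxx.
  (* For a = 1 the singularity equation determines b from y. For a = 0 it says tr (x y) = 0, and b
     is the trace of x (y + b y0). *)
  pose h (p : F * F) := if a == 0 then p.1 + p.2 * y0 else p.1.
  have h_inj : {in S &, injective h}.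
    move=> [y1 b1] [y2 b2]; rewrite !inE /h /=.
    move=> /andP[/eqP bitb1 /eqP Q1] /andP[/eqP bitb2 /eqP Q2].
    case/idem01: bita => a01; move: Q1 Q2; rewrite a01 ?eqxx ?oner_eq0.
      rewrite !mul0r !addr0 => try1 try2 eqh.
      have /(congr1 (fun w => tr (x * w))) := eqh.
      rewrite !mulrDr !(abs_traceD _ charF) try1 try2 ![x * (_ * y0)]mulrCA.
      rewrite (abs_trace_bitM _ bitb1) (abs_trace_bitM _ bitb2) y0P // !mulr1 !add0r => eqb.
      by move: eqh; rewrite eqb => /addIr ->.
    rewrite !mul1r => Q1 Q2 eqy; congr pair => //.
    by apply: (addrI (tr (x * y1))); rewrite Q1 eqy Q2.
  by rewrite -(card_in_imset h_inj) max_card.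
have imS : (fun s => kerdock_map s x a) @: F = S.
  apply/eqP; rewrite eqEcard card_imset => [|s t]; last exact: kerdock_inj.
  rewrite cardS andbT; apply/subsetP => _ /imsetP[s _ ->].
  by rewrite inE kerdock_singular ?bit_tr ?eqxx.
have : (y, b) \in S by rewrite inE /= bitb Qxy !eqxx.
by rewrite -imS => /imsetP[s _ ->]; exists s.
Qed.

End TraceColorings.

(** * The three types of form and the chromatic number *)

Lemma red_polar_form (R : comNzRingType) (charR : 2%N \in [pchar R])
  (n nu delta : nat) (z : 'Z_(2 ^ n)) (red := redZ charR (n := n))
  (a b : 'rV['Z_(2 ^ n)]_(2 * nu + delta)) :
  (0 < n)%N -> (delta <= 2)%N -> z \is a GRing.unit ->
  red ((a *m (Gmat nu delta z + (Gmat nu delta z)^T) *m b^T) 0 0)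
  = red ((lsubmx (split_vec a) *m (lsubmx (rsubmx (split_vec b)))^T) 0 0)
    + red ((lsubmx (split_vec b) *m (lsubmx (rsubmx (split_vec a)))^T) 0 0)
    + ((map_mx red (rsubmx (rsubmx (split_vec a))) *m tail2_mx R delta
          *m (map_mx red (rsubmx (rsubmx (split_vec b))))^T) 0 0
       + (map_mx red (rsubmx (rsubmx (split_vec b))) *m tail2_mx R delta
          *m (map_mx red (rsubmx (rsubmx (split_vec a))))^T) 0 0).
Proof.
move=> n_gt0 delta_le2 z_unit.
have red_tail (t u : 'rV_delta) : red ((t *m tail_mx delta z *m u^T) 0 0)
    = (map_mx red t *m tail2_mx R delta *m (map_mx red u)^T) 0 0.
  rewrite -(map_tail_mx charR n_gt0 delta_le2 z_unit) map_trmx -!map_mxM.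
  by rewrite [RHS]mxE.
by rewrite polar_hyp_form /hyp_form addrACA -!red_tail /red !rmorphD.
Qed.

Lemma split_vecZ (R : nzRingType) (nu delta : nat) (l : R)
  (a : 'rV[R]_(2 * nu + delta)) : split_vec (l *: a) = l *: split_vec a.
Proof. by apply/rowP => i; rewrite /split_vec castmxE !mxE castmxE. Qed.

(** The tail contributes t u + u t = 0 modulo 2: the last coordinate spans the radical and is
    dropped. *)
Lemma parabolic_colorable (n nu : nat) (z : 'Z_(2 ^ n)) :
  (0 < n)%N -> (0 < nu)%N -> z \is a GRing.unit ->
  orth_colorable nu 1 z (2 ^ nu + 1).
Proof.
move=> n_gt0 nu_gt0 z_unit.
have [F charF cardF] := pPrimePowerField (isT : prime 2) nu_gt0.
apply: (symplectic_colorable n_gt0 (charF := charF) cardF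
  (X := fun a => lsubmx (split_vec a))
  (Y := fun a => lsubmx (rsubmx (split_vec a)))) => [l a|l a|a b].
- by rewrite split_vecZ linearZ.
- by rewrite split_vecZ !linearZ.
rewrite red_polar_form // !tail2_form1 [X in _ + (_ + X)]mulrC.
by rewrite (addrr_pchar2 charF) addr0.
Qed.

(* Modulo 2 the polar form of the anisotropic tail is t0 u1 + t1 u0, one more
   hyperbolic pair. *)
Lemma elliptic_colorable (n nu : nat) (z : 'Z_(2 ^ n)) :
  (0 < n)%N -> z \is a GRing.unit -> orth_colorable nu 2 z (2 ^ (nu + 1) + 1).
Proof.
move=> n_gt0 z_unit.
have [|F charF cardF] := pPrimePowerField (isT : prime 2) (_ : 0 < nu + 1)%N.
  by rewrite addn1.
pose tail (i : 'I_2) (a : 'rV['Z_(2 ^ n)]_(2 * nu + 2)) : 'rV['Z_(2 ^ n)]_1 :=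
  const_mx (rsubmx (rsubmx (split_vec a)) 0 i).
have tailZ i l a : tail i (l *: a) = l *: tail i a.
  by rewrite /tail split_vecZ !linearZ; apply/rowP => j; rewrite !mxE.
apply: (symplectic_colorable n_gt0 (charF := charF) cardF
  (X := fun a => row_mx (lsubmx (split_vec a)) (tail 0 a))
  (Y := fun a => row_mx (lsubmx (rsubmx (split_vec a))) (tail 1 a)))
  => [l a|l a|a b].
- by rewrite tailZ split_vecZ linearZ scale_row_mx.
- by rewrite tailZ split_vecZ !linearZ scale_row_mx.
rewrite red_polar_form // !tail2_form2 !tr_row_mx !mul_row_col.
rewrite ![(_ *m _ + _ *m _) 0 0]mxE 2!rmorphD /=.
have tailE (i j : 'I_2) c d : (tail i c *m (tail j d)^T) 0 0
    = rsubmx (rsubmx (split_vec c)) 0 i * rsubmx (rsubmx (split_vec d)) 0 j.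
  by rewrite mxE big_ord1 !mxE.
rewrite !tailE !rmorphM /= ![map_mx _ _ 0 _]mxE.
move: (redZ _ _) (redZ _ _) (redZ _ _) (redZ _ _) (redZ _ _) (redZ _ _).
move=> ta1 tb1 tb0 ta0 xy xy'.
apply/eqP; rewrite -subr_eq0; apply/eqP.
(* Only the diagonal products of the tail are left over, each occurring twice. *)
transitivity (2%:R * (ta0 * tb0 + ta1 * tb1)); first by ring.
by rewrite (two_eq0 charF) mul0r.
Qed.

Lemma redZ_bit (F : fieldType) (charF : 2%N \in [pchar F]) (n : nat)
  (c : 'Z_(2 ^ n)) : redZ charF c ^+ 2 = redZ charF c.
Proof. by rewrite redZ_odd; case: odd; rewrite ?expr1n ?expr0n. Qed.

(** Each half of length nu = m + 1 is read as an element of [F] and a bit, and a singular vector is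
    colored by the spread member containing it. *)
Lemma hyperbolic_colorable (n m : nat) (z : 'Z_(2 ^ n)) :
  (0 < n)%N -> odd m -> orth_colorable (m + 1) 0 z (2 ^ m + 1).
Proof.
move=> n_gt0 m_odd.
have [F charF cardF] := pPrimePowerField (isT : prime 2) (odd_gt0 m_odd).
pose red := redZ charF (n := n).
have [e [f dual]] := abs_trace_dual_bases charF cardF.
have redD u v : red (u + v) = red u + red v by rewrite /red rmorphD.
pose left_part (a : 'rV['Z_(2 ^ n)]_(2 * (m + 1) + 0)) := lsubmx (split_vec a).
pose right_part (a : 'rV['Z_(2 ^ n)]_(2 * (m + 1) + 0)) :=
  lsubmx (rsubmx (split_vec a)).
pose x a := field_coord charF e (lsubmx (left_part a)).
pose y a := field_coord charF f (lsubmx (right_part a)).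
pose al a := red (rsubmx (left_part a) 0 0).
pose be a := red (rsubmx (right_part a) 0 0).
have formE a b : red (hyp_form (tail_mx 0 z) (split_vec a) (split_vec b))
    = abs_trace m (x a * y b) + al a * be b.
  rewrite /hyp_form -/(left_part a) -/(right_part b).
  have -> : rsubmx (rsubmx (split_vec a)) = 0 by apply/rowP => -[].
  rewrite !mul0mx [X in _ + X]mxE addr0 (trace_field_coord charF _ _ dual) /al /be.
  rewrite -rmorphM -rmorphD; congr (redZ charF _).
  rewrite -{1}[left_part a]hsubmxK -{1}[right_part b]hsubmxK tr_row_mx.
  by rewrite mul_row_col mxE; congr (_ + _); rewrite mxE big_ord1 !mxE.
(* [None] stands for the member x = a = 0. By [kerdock_surj] the default 0 can only arise at
   nonsingular vectors, where the color is irrelevant. *)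
pose col a := if (x a == 0) && (al a == 0) then None else
  Some (odflt 0 [pick s | kerdock_map m s (x a) (al a) == (y a, be a)]).
have -> : (2 ^ m + 1 = #|{: option F}|)%N by rewrite card_option cardF addn1.
have xaZ l a : l \is a GRing.unit -> [/\ x (l *: a) = x a, y (l *: a) = y a,
    al (l *: a) = al a & be (l *: a) = be a].
  move=> l_unit; rewrite /x /y /al /be /left_part /right_part split_vecZ.
  rewrite !linearZ /= !field_coordZ // ![(_ *: _ : 'M_(_, _)) _ _]mxE.
  by rewrite /red !rmorphM /= (redZ_unit charF n_gt0 l_unit) !mul1r.
apply: (orth_colorable_by (col := col)) => [l a l_unit|a b].
  by rewrite /col; have [-> -> -> ->] := xaZ l a l_unit.
rewrite !Gmat_hyp_form polar_hyp_form => /(congr1 red) Qa /(congr1 red) Qb eqab.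
rewrite (unit_redZ charF) // negbK -/red redD !formE.
move: Qa Qb; rewrite !formE [red 0]rmorph0 => Qa Qb; apply/eqP.
have colP c s : abs_trace m (x c * y c) + al c * be c = 0 -> col c = Some s ->
    kerdock_map m s (x c) (al c) = (y c, be c).
  rewrite /col => Qc; case: ifPn => //; rewrite negb_and => xal0 [<-].
  case: pickP => [s' /eqP //|]; have [s' s'P] : exists s',
    kerdock_map m s' (x c) (al c) = (y c, be c).
    by apply: (kerdock_surj charF cardF) => //; apply: redZ_bit.
  by move/(_ s'); rewrite s'P eqxx.
have colN c : col c = None -> x c = 0 /\ al c = 0.
  by rewrite /col; case: ifP => // /andP[/eqP-> /eqP->].
case cola : (col a) eqab => [s|] eqab.
  have bitE c : al c ^+ 2 = al c by apply: redZ_bit.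
  have := kerdock_polar charF cardF s (x a) (x b) (bitE a) (bitE b).
  by rewrite (colP a s Qa cola) (colP b s Qb (esym eqab)).
have [-> ->] := colN a cola; have [-> ->] := colN b (esym eqab).
by rewrite !mul0r abs_trace0 !addr0.
Qed.

Theorem theorem2p7 (n nu delta : nat) (z : 'Z_(2 ^ n)) :
  (1 <= n)%N -> (1 <= nu)%N -> (delta <= 2)%N ->
  ~ (delta = 0%N /\ odd nu) ->
  z \is a GRing.unit ->
  orth_chromatic_number nu delta z (2 ^ (nu + delta - 1) + 1).
Proof.
move=> n_gt0 nu_gt0 delta_le2 not_odd z_unit; split; last first.
  by move=> k; apply: orth_colorable_lower_bound.
case: delta delta_le2 not_odd => [|[|[|//]]] _ not_odd.
(* Here nu is even and positive, so m = nu - 1 is odd. *)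
- have nuE : nu = (nu - 1 + 1)%N by rewrite subnK.
  have m_odd : odd (nu - 1) by rewrite oddB // addbT; apply/negP => ?; apply: not_odd.
  by rewrite addn0 {1}nuE; apply: hyperbolic_colorable.
- by rewrite addnK; apply: parabolic_colorable.
have -> : (nu + 2 - 1 = nu + 1)%N by lia.
exact: elliptic_colorable.
Qed.
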